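(* Let $n_1\geq n_2\geq n_3\geq n_4\geq 1$ be integers with $n_1\geq n_2+2$. Let $H$ and $T$ be graphs with $|H|\geq 1$ and $|T|+\sum_{1\leq s\leq 4}n_s\geq 2000$. Put $$G_1=H\vee(P_{n_1}\cup P_{n_2}\cup P_{n_3}\cup P_{n_4}\cup T),$$ $$G_2=H\vee(P_{n_1-1}\cup P_{n_2+1}\cup P_{n_3+1}\cup P_{n_4-1}\cup T).$$ Then $\rho(G_1)<\rho(G_2)$.
   Context: All graphs are finite, undirected and simple. $|G|$ denotes the number of vertices of $G$ ($T$ is allowed to be the graph with no vertices). $P_n$ is the path on $n$ vertices, and $P_0$ denotes the empty graph (no vertices). $G\cup G'$ denotes the disjoint union of graphs, and $G\vee G'$ denotes the join, obtained from the disjoint union $G\cup G'$ by adding all edges between vertices of $G$ and vertices of $G'$. The spectral radius $\rho(G)$ is the largest eigenvalue of the adjacency matrix of $G$. *)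

(* Defs.v *)
From HB Require Import structures.
From mathcomp Require Import all_boot all_order all_algebra.
From mathcomp Require Import all_classical all_reals.
From mathcomp Require Import complex polyrcf spectral.

Set Implicit Arguments.
Unset Strict Implicit.
Unset Printing Implicit Defensive.

Import Order.TTheory GRing.Theory Num.Theory.

Local Open Scope complex_scope.
Local Open Scope ring_scope.

Record sgraph : Type := SGraph {
  vertex :> finType;
  adj : rel vertex;
  adj_sym : symmetric adj;
  adj_irrefl : irreflexive adj }.

Section PathGraph.
Variable n : nat.

Definition path_adj : rel 'I_n :=
  fun i j => (i.+1 == j :> nat) || (j.+1 == i :> nat).

Lemma path_adj_sym : symmetric path_adj.
Proof. by move=> i j; rewrite /path_adj orbC. Qed.

Lemma path_adj_irrefl : irreflexive path_adj.
Proof. by move=> i; rewrite /path_adj orbb gtn_eqF. Qed.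

Definition path_graph : sgraph := SGraph path_adj_sym path_adj_irrefl.

End PathGraph.

Section UnionJoin.
Variables G G' : sgraph.

(* Both graphs have vertex set G + G'; [cross] says whether a vertex of G and
   a vertex of G' are adjacent: false for the disjoint union, true for the
   join. *)
Definition sum_adj (cross : bool) : rel (vertex G + vertex G')%type :=
  fun u v => match u, v with
             | inl x, inl y => adj x y
             | inr x, inr y => adj x y
             | _, _ => cross
             end.

Lemma sum_adj_sym cross : symmetric (sum_adj cross).
Proof. by case=> x [] y //=; exact: adj_sym. Qed.

Lemma sum_adj_irrefl cross : irreflexive (sum_adj cross).
Proof. by case=> x /=; exact: adj_irrefl. Qed.

Definition disjoint_union : sgraph :=
  SGraph (sum_adj_sym false) (sum_adj_irrefl false).

Definition graph_join : sgraph :=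
  SGraph (sum_adj_sym true) (sum_adj_irrefl true).

End UnionJoin.

Section SpectralRadius.
Variables (R : realType) (G : sgraph).

Definition adjmx : 'M[R]_#|G| :=
  \matrix_(i, j) (adj (enum_val i) (enum_val j))%:R.

(* This is the largest eigenvalue: see [spectral_radius_max] below. *)
Definition spectral_radius : R := sup [set a | eigenvalue adjmx a]%classic.

Lemma adjmx_sym : adjmx^T = adjmx.
Proof. by apply/matrixP => i j; rewrite !mxE adj_sym. Qed.

Lemma adjmx_eigenvalue : (0 < #|G|)%N -> exists a, eigenvalue adjmx a.
Proof.
move=> G_gt0.
pose f : {rmorphism R -> R[i]} := real_complex R.
pose B := map_mx f adjmx.
have [l /eigenvalueP[v vB v0]] := eigenvalue_closed B G_gt0.
have BT : (map_mx Num.conj B)^T = B.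
  apply/matrixP => i j; rewrite !mxE adj_sym.
  by rewrite !rmorph_nat.
pose w := (map_mx Num.conj v)^T.
have Bw : B *m w = l^* *: w.
  have := congr1 (fun M => (map_mx Num.conj M)^T) vB.
  by rewrite /= map_mxM trmx_mul BT map_mxZ linearZ.
have w0 : (v *m w) 0 0 != 0.
  rewrite mxE; apply: contraNneq v0 => s0; apply/eqP/rowP => j; rewrite mxE.
  have /psumr_eq0P : forall i, true -> 0 <= v 0 i * w i 0.
    by move=> i _; rewrite !mxE mul_conjC_ge0.
  move=> /(_ s0 j isT); rewrite !mxE => /eqP.
  by rewrite mul_conjC_eq0 => /eqP.
have lC : l = l^*.
  have : (l *: (v *m w)) 0 0 = (l^* *: (v *m w)) 0 0.
    by rewrite scalemxAl -vB -mulmxA Bw scalemxAr.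
  by rewrite !mxE -[\sum_j _]/(_) => /mulIf; apply; move: w0; rewrite mxE.
have /complex_realP[a la] : l \is Num.real by rewrite CrealE -lC.
exists a; rewrite -(eigenvalue_map f) -[f a]la.
by apply/eigenvalueP; exists v.
Qed.

Lemma spectral_radius_max : (0 < #|G|)%N ->
  eigenvalue adjmx spectral_radius /\
  (forall a, eigenvalue adjmx a -> a <= spectral_radius).
Proof.
move=> /adjmx_eigenvalue[a0 a0_eig].
have p0 : char_poly adjmx != 0 by rewrite monic_neq0 ?char_poly_monic.
have rootsE a : eigenvalue adjmx a = (a \in rootsR (char_poly adjmx)).
  by rewrite -roots_on_rootsR // eigenvalue_root_char.
have [m m_eig m_max] : exists2 m, eigenvalue adjmx m &
    forall a, eigenvalue adjmx a -> a <= m.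
  have : exists2 m, m \in rootsR (char_poly adjmx) &
      forall a, a \in rootsR (char_poly adjmx) -> a <= m.
    move: a0_eig; rewrite rootsE; elim: (rootsR _) a0 => // x s IH a0 _.
    case: s IH => [|y s] IH.
      by exists x; rewrite ?mem_head // => a; rewrite inE => /eqP->.
    have [m ms mM] := IH y (mem_head _ _).
    have [xm|mx] := lerP x m.
      exists m; first by rewrite inE ms orbT.
      by move=> a; rewrite inE => /predU1P[->|/mM].
    exists x; first exact: mem_head.
    by move=> a; rewrite inE => /predU1P[->|/mM/le_trans->] //; exact: ltW.
  by case=> m mr mM; exists m => [|a]; rewrite rootsE //; exact: mM.
suff -> : spectral_radius = m by [].
have ubm : ubound [set a | eigenvalue adjmx a]%classic m by exact: m_max.
apply/eqP; rewrite eq_le; apply/andP; split.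
  by apply: ge_sup => //; exists m.
by apply: sup_upper_bound => //; split; exists m.
Qed.

End SpectralRadius.

(* Main.v *)
Require Import Defs.
From HB Require Import structures.
From mathcomp Require Import all_boot all_order all_algebra.
From mathcomp Require Import all_classical all_reals.
From mathcomp Require Import complex spectral zify ring lra.

(** In a join H v F with spectral radius rho, let x be a nonnegative
    eigenfunction for rho and s > 0 the sum of x over H.  On F the eigenvalue
    equation reads (rho - A_F) x = s 1, so the neighbourhood F acts on H only
    through the number W_F(rho) = 1^T (rho - A_F)^{-1} 1, which is the sum of
    x / s over F.  If another graph F' has a larger such number at the same
    rho, then keeping x on H and putting s (rho - A_F')^{-1} 1 on F' gives a
    test function whose Rayleigh quotient in H v F' exceeds rho, and hence
    rho(H v F) < rho(H v F').  This is [join_spectral_radius_lt]; it rests on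
    the Rayleigh bound for symmetric matrices [symmetric_rayleigh] and on the
    Perron eigenfunction [perron_eigenfunction].

    The number W is additive over disjoint unions, so the contribution of T
    cancels and only the paths matter.  Writing rho = t + 1/t with t > 1, the
    resolvent of a path is explicit, and W_{P_n} is an increasing affine
    function of n minus a positive multiple of
      g(n) = (t^n - 1) / (1 + t^(n+1))       ([path_defect]).
    The total number of path vertices does not change, so, with increments
    e(n) = g(n+1) - g(n), the theorem becomes
      e(n2) + e(n3) < e(n1 - 1) + e(n4 - 1).
    Now e is positive, and e(n+1) <= e(n) / 2 as soon as t >= 3; since
    n4 <= n3 <= n2, the left side is at most 2 e(n4) <= e(n4 - 1).  The bound
    t >= 3 comes from rho^2 >= |F| >= 2000. *)

Set Implicit Arguments.
Unset Strict Implicit.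
Unset Printing Implicit Defensive.

Import Order.TTheory GRing.Theory Num.Theory.

Local Open Scope sesquilinear_scope.
Local Open Scope ring_scope.

(** * Rayleigh quotients of symmetric matrices *)

(** Over the complex numbers the matrix is unitarily diagonalizable with real
    eigenvalues d i; in the coordinates z of v along an orthonormal eigenbasis
    the two sides are the sums of d i * |z i|^2 and of r * |z i|^2. *)
Lemma symmetric_rayleigh (R : rcfType) n (A : 'M[R]_n) (r : R) :
  A^T = A -> (forall a, eigenvalue A a -> a <= r) ->
  forall v : 'rV_n, (v *m A *m v^T) 0 0 <= r * (v *m v^T) 0 0.
Proof.
move=> AT r_max v.
pose f : {rmorphism R -> R[i]} := real_complex R.
have fconj x : Num.conj (f x) = f x by apply/CrealP/complex_realP; exists x.
pose B := map_mx f A.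
have Bherm : B \is hermsymmx.
  apply: realsym_hermsym.
    apply/is_hermitianmxP; rewrite expr0 scale1r.
    by apply/matrixP => i j; rewrite !mxE -[in LHS]AT mxE.
  by apply/mxOverP => i j; rewrite mxE; apply/complex_realP; exists (A i j).
pose P := spectralmx B; pose d := spectral_diag B.
have P_unit : P \is unitarymx := spectral_unitarymx B.
have BE : B = P^t* *m diag_mx d *m P.
  rewrite -(invmx_unitary P_unit).
  exact/orthomx_spectralP/hermitian_normalmx.
have d_le i : d 0 i <= f r.
  have /complex_realP[a da] : d 0 i \is Num.real.
    by have /mxOverP := hermitian_spectral_diag_real Bherm; apply.
  have da' : d 0 i = f a by [].
  rewrite da' lecR; apply: r_max; rewrite -(eigenvalue_map f) -da'.
  apply/eigenvalueP; exists (row i P).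
    rewrite -row_mul -/B BE !mulmxA (unitarymxP P_unit) mul1mx.
    by apply/rowP => j; rewrite mul_diag_mx !mxE.
  apply: contraTneq isT => Pi0.
  have /matrixP/(_ i i) := unitarymxP P_unit.
  rewrite !mxE eqxx big1 ?(eqxx, eq_sym, oner_eq0) => [/eqP|j _].
    by rewrite eq_sym oner_eq0.
  by have /rowP/(_ j) := Pi0; rewrite !mxE => ->; rewrite mul0r.
(* The coordinates of v in the eigenbasis given by the rows of P. *)
pose w := map_mx f v; pose z := w *m P^t*.
have wT : (map_mx f v)^T = w^t*.
  by apply/matrixP => i j; rewrite !mxE fconj.
have zT : z^t* = P *m w^t*.
  by rewrite trmx_mul map_mxM trmxCK.
rewrite -lecR -/(f _).
have -> : f ((v *m A *m v^T) 0 0) = \sum_i d 0 i * `|z 0 i| ^+ 2.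
  have -> : f ((v *m A *m v^T) 0 0) = (z *m diag_mx d *m z^t*) 0 0.
    rewrite zT /z !mulmxA -!(mulmxA w) -BE mulmxA.
    by rewrite -wT map_trmx -!map_mxM [in RHS]mxE.
  rewrite mxE; apply: eq_bigr => i _.
  by rewrite mul_mx_diag !mxE normCK mulrAC mulrC.
have -> : f (r * (v *m v^T) 0 0) = \sum_i f r * `|z 0 i| ^+ 2.
  rewrite rmorphM -mulr_sumr; congr (_ * _).
  have -> : f ((v *m v^T) 0 0) = (z *m z^t*) 0 0.
    by rewrite zT /z mulmxA mulmxKtV // -wT map_trmx -map_mxM [in RHS]mxE.
  by rewrite mxE; apply: eq_bigr => i _; rewrite normCK !mxE.
by apply: ler_sum => i _; rewrite ler_wpM2r // exprn_ge0.
Qed.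

(** * Adjacency operator and Perron eigenfunction *)

Section AdjacencyOperator.
Variables (R : realType) (G : sgraph).
Implicit Types x y : G -> R.

Lemma sum_vertices x : \sum_v x v = \sum_(i < #|G|) x (enum_val i).
Proof. by rewrite -(big_enum_val x). Qed.

Definition adj_op x (v : G) : R := \sum_(u : G) (adj v u)%:R * x u.

Lemma adj_op_self_adjoint x y :
  \sum_v x v * adj_op y v = \sum_v y v * adj_op x v.
Proof.
under eq_bigr do rewrite mulr_sumr.
rewrite exchange_big; apply: eq_bigr => u _; rewrite mulr_sumr.
by apply: eq_bigr => v _; rewrite adj_sym; ring.
Qed.

Lemma adj_opD x y c v :
  adj_op (fun u => x u + c * y u) v = adj_op x v + c * adj_op y v.
Proof.
rewrite /adj_op mulr_sumr -big_split; apply: eq_bigr => u _ /=; ring.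
Qed.

Lemma spectral_radius_rayleigh x : (0 < #|G|)%N ->
  \sum_v x v * adj_op x v <= spectral_radius R G * \sum_v x v ^+ 2.
Proof.
move=> /(spectral_radius_max R)[_ rho_max].
have := symmetric_rayleigh (adjmx_sym R G) rho_max (\row_i x (enum_val i)).
rewrite -mulmxA !mxE.
congr (_ <= _ * _); rewrite sum_vertices; apply: eq_bigr => i _ /=.
  rewrite !mxE; congr (_ * _); rewrite /adj_op sum_vertices.
  by apply: eq_bigr => j _; rewrite !mxE.
by rewrite !mxE.
Qed.

Lemma spectral_radius_eigenfunction : (0 < #|G|)%N ->
  exists2 x, exists v, x v != 0 &
    forall v, spectral_radius R G * x v = adj_op x v.
Proof.
move=> /(spectral_radius_max R)[/eigenvalueP[w wE w0] _].
exists (fun v => w 0 (enum_rank v)).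
  have /rV0Pn[i wi] := w0.
  by exists (enum_val i); rewrite enum_valK.
move=> v; have /rowP/(_ (enum_rank v)) := wE; rewrite !mxE => <-.
rewrite /adj_op sum_vertices; apply: eq_bigr => i _.
by rewrite !mxE enum_valK enum_rankK adj_sym mulrC.
Qed.

(** The form q(z) = rho |z|^2 - <z, A z> is nonnegative by the Rayleigh bound
    and vanishes at x.  Perturbing x along its residual r = rho x - A x gives
    q(x + e r) <= 2 e |r|^2 + e^2 q(r), which would be negative for small
    negative e unless r = 0. *)
Lemma spectral_radius_maximizer x : (0 < #|G|)%N ->
  spectral_radius R G * \sum_v x v ^+ 2 <= \sum_v x v * adj_op x v ->
  forall v, spectral_radius R G * x v = adj_op x v.
Proof.
move=> G_gt0 x_max.
set rho := spectral_radius R G in x_max *.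
pose r v := rho * x v - adj_op x v.
pose S := \sum_v r v ^+ 2.
have S_ge0 : 0 <= S by apply: sumr_ge0 => v _; rewrite sqr_ge0.
pose Q := rho * \sum_v r v ^+ 2 - \sum_v r v * adj_op r v.
have Q_ge0 : 0 <= Q by rewrite subr_ge0 spectral_radius_rayleigh.
have q_ge0 e : 0 <= e * (2 * S + e * Q).
  have := spectral_radius_rayleigh (fun v => x v + e * r v) G_gt0.
  under eq_bigr do rewrite adj_opD.
  have -> : \sum_v (x v + e * r v) * (adj_op x v + e * adj_op r v) =
    \sum_v x v * adj_op x v + e * \sum_v r v * adj_op x v
    + e * \sum_v x v * adj_op r v + e ^+ 2 * \sum_v r v * adj_op r v.
    rewrite !mulr_sumr -!big_split; apply: eq_bigr => v _ /=; ring.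
  have -> : \sum_v (x v + e * r v) ^+ 2 =
    \sum_v x v ^+ 2 + 2 * e * \sum_v r v * x v + e ^+ 2 * \sum_v r v ^+ 2.
    rewrite !mulr_sumr -!big_split; apply: eq_bigr => v _ /=; ring.
  rewrite (adj_op_self_adjoint x r).
  have -> : S = rho * \sum_v r v * x v - \sum_v r v * adj_op x v.
    rewrite /S mulr_sumr -sumrB; apply: eq_bigr => v _; rewrite /r; ring.
  rewrite -/rho /Q.
  move: x_max; set s0 := \sum_v x v ^+ 2; set s1 := \sum_v x v * _.
  nra.
have S0 : S = 0.
  apply/eqP; rewrite eq_le S_ge0 andbT leNgt; apply/negP => S_gt0.
  (* Any e < 0 with |e| Q < 2 S would do; Q + 1 avoids dividing by Q = 0. *)
  have := q_ge0 (- S / (Q + 1)).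
  have -> : - S / (Q + 1) * (2 * S + - S / (Q + 1) * Q) =
    - (S ^+ 2 * (Q + 2) / (Q + 1) ^+ 2) by field; lra.
  rewrite oppr_ge0 leNgt divr_gt0 //.
    by rewrite mulr_gt0 ?exprn_gt0 //; lra.
  by rewrite exprn_gt0 //; lra.
move=> v; apply/eqP; rewrite -subr_eq0 -sqrf_eq0; apply/eqP.
by apply: (psumr_eq0P _ S0) => // u _; rewrite sqr_ge0.
Qed.

(** Replacing an eigenfunction for rho by its absolute value cannot decrease
    <x, A x>, because A has nonnegative entries, so the absolute value still
    attains the maximal Rayleigh quotient. *)
Lemma perron_eigenfunction : (0 < #|G|)%N ->
  exists x, [/\ forall v, 0 <= x v, exists v, x v != 0 &
    forall v, spectral_radius R G * x v = adj_op x v].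
Proof.
move=> G_gt0; have [x [w xw] xE] := spectral_radius_eigenfunction G_gt0.
exists (fun v => `|x v|); split=> [v||]; first exact: normr_ge0.
  by exists w; rewrite normr_eq0.
apply: spectral_radius_maximizer => //.
have -> : spectral_radius R G * \sum_v `|x v| ^+ 2 =
    \sum_v x v * adj_op x v.
  rewrite mulr_sumr; apply: eq_bigr => v _.
  by rewrite real_normK ?num_real // -xE; ring.
apply: ler_sum => v _; apply: le_trans (ler_norm _) _.
rewrite normrM ler_wpM2l // (le_trans (ler_norm_sum _ _ _)) //.
by apply: ler_sum => u _; rewrite normrM normr_nat.
Qed.

End AdjacencyOperator.

(** * Resolvent totals and spectral radii of joins *)

Section ResolventTotal.
Variable R : realType.

(** That is, f solves (lam - A_F) f = 1.  Stating the equation instead of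
    inverting lam - A_F keeps the notion meaningful when lam is an eigenvalue
    of F. *)
Definition ones_resolvent (lam : R) (F : sgraph) (f : F -> R) :=
  forall v, lam * f v = adj_op f v + 1.

Definition resolvent_total (lam : R) (F : sgraph) (W : R) :=
  exists2 f : F -> R, ones_resolvent lam f & \sum_v f v = W.

(** The solution f need not be unique, but its sum is: for two solutions f
    and g, self-adjointness gives
    <f, 1> = <f, (lam - A) g> = <(lam - A) f, g> = <1, g>. *)
Lemma resolvent_total_unique lam F W W' :
  resolvent_total lam F W -> resolvent_total lam F W' -> W = W'.
Proof.
move=> [f fE <-] [g gE <-].
have sumE (h k : F -> R) : ones_resolvent lam k ->
    \sum_v h v = lam * (\sum_v h v * k v) - \sum_v h v * adj_op k v.
  move=> kE; rewrite mulr_sumr -sumrB; apply: eq_bigr => v _.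
  by rewrite mulrCA kE; ring.
rewrite (sumE f g gE) (sumE g f fE) adj_op_self_adjoint.
by congr (_ * _ - _); apply: eq_bigr => v _; rewrite mulrC.
Qed.

Lemma adj_op_union_inl (F F' : sgraph) (f : disjoint_union F F' -> R) v :
  adj_op f (inl v) = adj_op (fun u => f (inl u)) v.
Proof.
rewrite /adj_op big_sumType /= [X in _ + X]big1 ?addr0 // => u _.
by rewrite mul0r.
Qed.

Lemma adj_op_union_inr (F F' : sgraph) (f : disjoint_union F F' -> R) v :
  adj_op f (inr v) = adj_op (fun u => f (inr u)) v.
Proof.
rewrite /adj_op big_sumType /= [X in X + _]big1 ?add0r // => u _.
by rewrite mul0r.
Qed.

Lemma adj_op_join_inl (H F : sgraph) (x : graph_join H F -> R) v :
  adj_op x (inl v) = adj_op (fun u => x (inl u)) v + \sum_u x (inr u).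
Proof.
rewrite /adj_op big_sumType; congr (_ + _).
by apply: eq_bigr => u _; rewrite mul1r.
Qed.

Lemma adj_op_join_inr (H F : sgraph) (x : graph_join H F -> R) v :
  adj_op x (inr v) = \sum_u x (inl u) + adj_op (fun u => x (inr u)) v.
Proof.
rewrite /adj_op big_sumType; congr (_ + _).
by apply: eq_bigr => u _; rewrite mul1r.
Qed.

Lemma resolvent_total_unionP lam F F' W :
  resolvent_total lam (disjoint_union F F') W <->
  exists W1 W2, [/\ resolvent_total lam F W1, resolvent_total lam F' W2 &
    W = W1 + W2].
Proof.
split=> [[f fE <-]|[W1 [W2 [[f fE <-] [g gE <-] ->]]]].
  exists (\sum_v f (inl v)), (\sum_v f (inr v)); split.
  - by exists (fun v => f (inl v)) => // v; rewrite fE adj_op_union_inl.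
  - by exists (fun v => f (inr v)) => // v; rewrite fE adj_op_union_inr.
  - by rewrite big_sumType.
exists (fun v : disjoint_union F F' =>
  match v with inl u => f u | inr u => g u end).
  by case=> v; rewrite ?adj_op_union_inl ?adj_op_union_inr ?fE ?gE.
by rewrite big_sumType.
Qed.

Lemma resolvent_total_union lam F F' W W' :
  resolvent_total lam F W -> resolvent_total lam F' W' ->
  resolvent_total lam (disjoint_union F F') (W + W').
Proof. by move=> FW F'W'; apply/resolvent_total_unionP; exists W, W'. Qed.

(** The function x / s restricted to F, with x a Perron eigenfunction of the
    join and s its sum over H, provides the resolvent total W.  For F' with a
    larger total, x on H extended by s times the resolvent solution on F'
    satisfies A y = rho y on F' and A y = rho y + s (W' - W) on H, so its
    Rayleigh quotient exceeds rho.  The bound on #|F| follows from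
    #|F| s <= rho u and u <= rho s, where u is the sum of x over F: the
    values rho x are at least s on F and at least u on H. *)
Lemma join_spectral_radius_lt (H F : sgraph) :
  (0 < #|H|)%N ->
  let rho := spectral_radius R (graph_join H F) in
  [/\ 0 <= rho, #|F|%:R <= rho ^+ 2 &
   exists2 W, resolvent_total rho F W &
   forall F' W', resolvent_total rho F' W' -> W < W' ->
     rho < spectral_radius R (graph_join H F')].
Proof.
move=> H_gt0 rho.
have join_gt0 F0 : (0 < #|graph_join H F0|)%N.
  by rewrite card_sum addn_gt0 H_gt0.
have [x [x_ge0 [w xw] xE]] := perron_eigenfunction R (join_gt0 F).
rewrite -/rho in xE.
pose s := \sum_v x (inl v); pose u := \sum_v x (inr v).
have s_ge0 : 0 <= s by apply: sumr_ge0.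
have u_ge0 : 0 <= u by apply: sumr_ge0.
have [h _] := card_gt0P H_gt0.
have HE v : rho * x (inl v) = adj_op (fun v => x (inl v)) v + u.
  by rewrite xE adj_op_join_inl.
have FE v : rho * x (inr v) = s + adj_op (fun v => x (inr v)) v.
  by rewrite xE adj_op_join_inr.
have adj_ge0 (G : sgraph) (y : G -> R) v :
    (forall v, 0 <= y v) -> 0 <= adj_op y v.
  by move=> y_ge0; apply: sumr_ge0 => a _; rewrite mulr_ge0.
(* If x vanished on H, the equation at any vertex of H would force x to
   vanish on F as well. *)
have s_gt0 : 0 < s.
  rewrite lt_neqAle s_ge0 andbT eq_sym; apply: contraNneq xw => s0.
  have xH v : x (inl v) = 0 by apply: (psumr_eq0P _ s0).
  have u0 : u = 0.
    have := HE h; rewrite xH mulr0 => /esym/eqP.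
    by rewrite paddr_eq0 ?adj_ge0 // => /andP[_ /eqP].
  have xF v : x (inr v) = 0 by apply: (psumr_eq0P _ u0).
  by case: w => v; rewrite ?xH ?xF.
have u_le : u <= rho * s.
  rewrite /s mulr_sumr.
  apply: le_trans (_ : rho * x (inl h) <= _); first by rewrite HE lerDr adj_ge0.
  rewrite (bigD1 h) //= lerDl sumr_ge0 // => v _.
  by rewrite HE addr_ge0 ?adj_ge0.
have rho_ge0 : 0 <= rho.
  by rewrite -(pmulr_lge0 _ s_gt0) (le_trans u_ge0).
have s_le : #|F|%:R * s <= rho * u.
  rewrite [leRHS]mulr_sumr mulr_natl -sumr_const; apply: ler_sum => v _.
  by rewrite FE lerDl adj_ge0.
split=> //.
  rewrite -(ler_pM2r s_gt0) (le_trans s_le) // expr2 -mulrA.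
  by rewrite ler_wpM2l.
exists (u / s).
  exists (fun v => x (inr v) / s); last by rewrite -mulr_suml.
  move=> v; rewrite mulrA FE mulrDl divff ?gt_eqF // addrC; congr (_ + _).
  by rewrite /adj_op mulr_suml; apply: eq_bigr => a _; rewrite mulrA.
move=> F' W' [f fE <-] W_lt.
pose y (v : graph_join H F') : R :=
  match v with inl a => x (inl a) | inr a => s * f a end.
have sum_gt : u < \sum_a s * f a by rewrite -mulr_sumr mulrC -ltr_pdivrMr.
have yF v : rho * y (inr v) = adj_op y (inr v).
  rewrite adj_op_join_inr /= mulrCA fE mulrDr mulr1 addrC; congr (_ + _).
  by rewrite /adj_op mulr_sumr; apply: eq_bigr => a _; rewrite mulrCA.
have yH v : adj_op y (inl v) = rho * y (inl v) + (\sum_a s * f a - u).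
  by rewrite adj_op_join_inl /= HE; ring.
have := spectral_radius_rayleigh y (join_gt0 F').
have -> : \sum_v y v * adj_op y v =
    rho * (\sum_v y v ^+ 2) + s * (\sum_a s * f a - u).
  rewrite !big_sumType /= mulrDr !mulr_sumr mulr_suml addrAC -big_split.
  congr (_ + _); apply: eq_bigr => v _ /=; first by rewrite yH /=; ring.
  by rewrite -yF /=; ring.
rewrite ltNge; set rho' := spectral_radius _ _ => y_le; apply/negP => rho'_le.
have /(ler_wpM2r)/(_ _ _ rho'_le) : 0 <= \sum_v y v ^+ 2.
  by apply: sumr_ge0 => v _; rewrite sqr_ge0.
apply/negP; rewrite -ltNge (lt_le_trans _ y_le) // ltrDl mulr_gt0 //.
by rewrite subr_gt0.
Qed.

End ResolventTotal.

(** * Increments of the path totals *)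

Section PathTotals.
Variable R : realFieldType.
Implicit Type t : R.

(** For lam = t + 1/t, the resolvent solution takes the value
    t / (t - 1) * path_defect t n at each end of the path.  This measures how
    far its total falls short of n / (lam - 2), the total of the constant
    solution 1 / (lam - 2) on a cycle. *)
Definition path_defect (t : R) (n : nat) : R := (t ^+ n - 1) / (1 + t ^+ n.+1).

Definition path_total (t : R) (n : nat) : R :=
  t / (t - 1) ^+ 2 * (n%:R - 2 * (t / (t - 1)) * path_defect t n).

Lemma path_defect_step t n : 1 < t ->
  path_defect t n.+1 - path_defect t n =
  t ^+ n * (t ^+ 2 - 1) / ((1 + t ^+ n.+1) * (1 + t ^+ n.+2)).
Proof.
move=> t_gt1; have q_gt0 : 0 < t ^+ n by rewrite exprn_gt0 //; lra.
rewrite /path_defect !exprS; move: (t ^+ n) q_gt0 => q q_gt0.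
have tq_gt0 : 0 < t * q by rewrite mulr_gt0 //; lra.
have ttq_gt0 : 0 < t * (t * q) by rewrite mulr_gt0 //; lra.
by field; rewrite !gt_eqF //; lra.
Qed.

Lemma path_defect_step_gt0 t n : 1 < t ->
  0 < path_defect t n.+1 - path_defect t n.
Proof.
move=> t_gt1; rewrite path_defect_step //.
have pow_gt0 m : 0 < t ^+ m by rewrite exprn_gt0 //; lra.
have t2_gt1 : 0 < t ^+ 2 - 1 by rewrite subr_gt0 exprn_egt1.
by rewrite divr_gt0 ?mulr_gt0 // addr_gt0.
Qed.

(** After dividing by common positive factors the claim is
    2 t (1 + t q) <= 1 + t^3 q with q = t^n >= 1; at n = 0 this reads
    2 t + 2 t^2 <= 1 + t^3, which already fails for t = 2. *)
Lemma path_defect_step_half t n : 3 <= t ->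
  2 * (path_defect t n.+2 - path_defect t n.+1) <=
  path_defect t n.+1 - path_defect t n.
Proof.
move=> t_ge3; rewrite !path_defect_step; [|lra..].
have q_ge1 : 1 <= t ^+ n by rewrite exprn_ege1 //; lra.
rewrite !exprS; move: (t ^+ n) q_ge1 => q q_ge1; rewrite expr0 mulr1.
have A0 : 0 < 1 + t * q by nra.
have B0 : 0 < 1 + t * (t * q) by nra.
have C0 : 0 < 1 + t * (t * (t * q)) by nra.
rewrite -subr_ge0.
set lhs := (X in 0 <= X).
have -> : lhs = q * (t * t - 1) / (1 + t * (t * q)) *
   ((1 + t * (t * (t * q)) - 2 * t * (1 + t * q)) /
    ((1 + t * q) * (1 + t * (t * (t * q))))).
  by rewrite /lhs; field; rewrite !gt_eqF.
have num_ge0 : 0 <= 1 + t * (t * (t * q)) - 2 * t * (1 + t * q).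
  have : 0 <= (t * t * q) * (t - 3) by rewrite !mulr_ge0 //; lra.
  have : 0 <= t * ((t * q) - 2) by rewrite mulr_ge0 //; nra.
  nra.
rewrite mulr_ge0 // divr_ge0 ?mulr_ge0 //; try exact: ltW; [lra|nra].
Qed.

Lemma path_defect_step_antitone t m n : 3 <= t -> (m <= n)%N ->
  path_defect t n.+1 - path_defect t n <= path_defect t m.+1 - path_defect t m.
Proof.
move=> t_ge3; elim: n => [|n IH]; first by rewrite leqn0 => /eqP ->.
rewrite leq_eqVlt => /predU1P[->//|/IH]; apply: le_trans.
have := path_defect_step_half n t_ge3.
have : 0 < path_defect t n.+2 - path_defect t n.+1.
  by apply: path_defect_step_gt0; lra.
lra.
Qed.

(** The linear parts of the totals cancel, and what remains is a positive
    multiple of e(n1) + e(n4) - e(n2) - e(n3), where e is the increment of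
    [path_defect].  The loss e(n2) + e(n3) is at most 2 e(n4 + 1) <= e(n4),
    so the positive term e(n1) makes the inequality strict. *)
Lemma path_totals_lt (t : R) n1 n2 n3 n4 : 3 <= t ->
  (n4 < n3)%N -> (n3 <= n2)%N ->
  path_total t n1.+1 + path_total t n2 + path_total t n3 + path_total t n4.+1 <
  path_total t n1 + path_total t n2.+1 + path_total t n3.+1 + path_total t n4.
Proof.
move=> t_ge3 n43 n32.
have step1 : 0 < path_defect t n1.+1 - path_defect t n1.
  by apply: path_defect_step_gt0; lra.
have step2 := path_defect_step_antitone t_ge3 (leq_trans n43 n32).
have step3 := path_defect_step_antitone t_ge3 n43.
have step4 := path_defect_step_half n4 t_ge3.
rewrite -subr_gt0 /path_total.
set K := t / (t - 1); set C := t / (t - 1) ^+ 2.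
have K_gt0 : 0 < K by rewrite divr_gt0 //; lra.
have C_gt0 : 0 < C by rewrite divr_gt0 ?exprn_gt0 //; lra.
move: K C K_gt0 C_gt0 => K C K_gt0 C_gt0; set diff := (X in 0 < X).
have -> : diff = C * (2 * K) *
  ((path_defect t n1.+1 - path_defect t n1)
   - (path_defect t n2.+1 - path_defect t n2)
   - (path_defect t n3.+1 - path_defect t n3)
   + (path_defect t n4.+1 - path_defect t n4)).
  by rewrite /diff -!natr1; ring.
by rewrite !mulr_gt0 //; lra.
Qed.

End PathTotals.

(** * Resolvents of paths *)

(** Vertex i of the path is point i + 1 of the discrete interval [0, n + 1],
    and F vanishing at both extra points is the Dirichlet condition that lets
    every vertex, ends included, obey the same recurrence. *)
Lemma adj_op_path (R : realType) (n : nat) (F : nat -> R) (i : path_graph n) :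
  F 0%N = 0 -> F n.+1 = 0 ->
  adj_op (fun j : path_graph n => F (j : 'I_n).+1) i
    = F (i : 'I_n) + F (i : 'I_n).+2.
Proof.
move=> F0 Fn; rewrite /adj_op.
have pick_vertex k : \sum_(j < n) (k == j.+1)%:R * F j.+1 =
    if (0 < k <= n)%N then F k else 0.
  case: ifPn => [/andP[k_gt0 k_le]|k_out].
    have k_lt : (k.-1 < n)%N by rewrite prednK.
    rewrite (bigD1 (Ordinal k_lt)) //= prednK // eqxx mul1r big1 ?addr0 // => j.
    apply: contraNeq; rewrite mulf_eq0 negb_or => /andP[kj _].
    apply/eqP/val_inj => /=; move: kj.
    by rewrite pnatr_eq0 eqb0 negbK => /eqP ->.
  apply: big1 => j _; case: eqP k_out => [->|_ _]; last by rewrite mul0r.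
  by rewrite ltn_ord.
transitivity (\sum_(j < n) ((i : 'I_n) == j.+1 :> nat)%:R * F j.+1 +
    \sum_(j < n) ((i : 'I_n).+2 == j.+1)%:R * F j.+1).
  rewrite -big_split; apply: eq_bigr => j _ /=.
  rewrite -mulrDl -natrD /path_adj eqSS [(i : nat) == _]eq_sym.
  congr (_%:R * _).
  by case: eqP => [<-|_]; [rewrite gtn_eqF | case: eqP].
rewrite !pick_vertex; have := ltn_ord i => i_lt; congr (_ + _).
  by case: (i : nat) i_lt => //= k /ltnW ->.
case: ifPn => //=; rewrite -leqNgt => n_le.
by have -> : (i : 'I_n).+1 = n by apply/eqP; rewrite eqn_leq i_lt.
Qed.

(** The constant t / (t - 1)^2 = 1 / (lam - 2) solves the recurrence, t^k and
    t^(-k) solve its homogeneous version, and the combination F vanishing at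
    0 and n + 1 is the solution.  Its sum S needs no geometric series: adding
    up the recurrence over the path gives lam S = 2 S - F(1) - F(n) + n. *)
Lemma path_resolvent_total (R : realType) (t : R) n : 1 < t ->
  resolvent_total (t + t^-1) (path_graph n) (path_total t n).
Proof.
move=> t_gt1.
have t0 : t != 0 by rewrite gt_eqF //; lra.
have t10 : t - 1 != 0 by rewrite gt_eqF //; lra.
have D0 m : 1 + t ^+ m != 0.
  by rewrite gt_eqF // addr_gt0 // exprn_gt0 //; lra.
pose F k := t / (t - 1) ^+ 2 *
  (1 - (t ^+ k + t ^+ (n.+1 - k)) / (1 + t ^+ n.+1)).
have F0 : F 0%N = 0 by rewrite /F subn0 expr0 divff // subrr mulr0.
have Fn : F n.+1 = 0.
  by rewrite /F subnn expr0 [_ + 1]addrC divff // subrr mulr0.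
have FE k : (k < n)%N -> (t + t^-1) * F k.+1 = F k + F k.+2 + 1.
  move=> k_lt; rewrite /F.
  have -> : (n.+1 - k = (n.+1 - k.+2).+2)%N by lia.
  have -> : (n.+1 - k.+1 = (n.+1 - k.+2).+1)%N by lia.
  have := D0 n.+1; move: (1 + _) => D D0'; rewrite !exprS.
  by field; rewrite t0 t10 D0'.
have fE : ones_resolvent (t + t^-1)
    (fun j : path_graph n => F (j : 'I_n).+1).
  by move=> i; rewrite adj_op_path // FE.
eexists; first exact: fE.
have shift_down : \sum_(i < n) F i + F n = \sum_(i < n) F i.+1.
  rewrite -(big_ord_recr n (fun i => F i)) big_ord_recl /= F0 add0r.
  by apply: eq_bigr.
have shift_up : \sum_(i < n) F i.+2 + F 1%N = \sum_(i < n) F i.+1.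
  transitivity (\sum_(i < n.+1) F i.+1).
    by rewrite big_ord_recl addrC; congr (_ + _); apply: eq_bigr.
  by rewrite big_ord_recr /= Fn addr0.
have sumE : (t + t^-1) * \sum_(i < n) F i.+1 =
    2 * (\sum_(i < n) F i.+1) - F 1%N - F n + n%:R.
  rewrite mulr_sumr (eq_bigr (fun i : 'I_n => F i + F i.+2 + 1)); last first.
    by move=> i _; rewrite FE.
  rewrite !big_split /= sumr_const card_ord -{1}shift_down.
  lra.
have F1E : F 1%N + F n = 2 * (t / (t - 1)) * path_defect t n.
  rewrite /F subSnn subSS subn0 /path_defect !exprS.
  have := D0 n.+1; rewrite exprS => Dn; by field; rewrite t10 Dn.
have -> : \sum_v F (v : 'I_n).+1 = \sum_(i < n) F i.+1 by [].
rewrite /path_total -F1E.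
have -> : n%:R = (t + t^-1 - 2) * \sum_(i < n) F i.+1 + F 1%N + F n.
  by rewrite mulrBl sumE; ring.
by field; rewrite t0 t10.
Qed.

(** The larger root t of t^2 - lam t + 1, which is at least lam / 2. *)
Lemma exists_add_inverse (R : rcfType) (lam : R) : 6 <= lam ->
  exists2 t, 3 <= t & lam = t + t^-1.
Proof.
move=> lam_ge; pose r := Num.sqrt (lam ^+ 2 - 4).
have lam2_ge4 : 0 <= (lam - 2) * (lam + 2) by rewrite mulr_ge0 //; lra.
have r2 : r ^+ 2 = lam ^+ 2 - 4 by rewrite sqr_sqrtr //; lra.
have r_ge0 : 0 <= r := sqrtr_ge0 _.
exists ((lam + r) / 2); first by rewrite ler_pdivlMr; lra.
have d0 : lam + r != 0 by rewrite gt_eqF //; lra.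
apply: (mulIf d0); rewrite mulrDl invf_div mulfVK //.
lra.
Qed.

(** * The comparison *)

Theorem lemma1p2 (R : realType) (n1 n2 n3 n4 : nat) (H T : sgraph)
  (n21 : (n2 <= n1)%N) (n32 : (n3 <= n2)%N) (n43 : (n4 <= n3)%N)
  (n4_ge1 : (1 <= n4)%N)
  (n1_ge : (n2 + 2 <= n1)%N)
  (H_ge1 : (1 <= #|H|)%N)
  (size_ge : (2000 <= #|T| + (n1 + n2 + n3 + n4))%N) :
  let G1 := graph_join H (disjoint_union (disjoint_union (disjoint_union
              (disjoint_union (path_graph n1) (path_graph n2))
              (path_graph n3)) (path_graph n4)) T) in
  let G2 := graph_join H (disjoint_union (disjoint_union (disjoint_union
              (disjoint_union (path_graph (n1 - 1)) (path_graph (n2 + 1)))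
              (path_graph (n3 + 1))) (path_graph (n4 - 1))) T) in
  spectral_radius R G1 < spectral_radius R G2.
Proof.
cbv zeta.
set F1 := disjoint_union _ T; set F2 := disjoint_union _ T.
have [rho_ge0 rho_sqr [W F1W rho_max]] := join_spectral_radius_lt R F1 H_ge1.
set rho := spectral_radius R (graph_join H F1) in rho_ge0 rho_sqr F1W rho_max *.
have [t t_ge3 rhoE] : exists2 t, 3 <= t & rho = t + t^-1.
  apply: exists_add_inverse; rewrite leNgt; apply/negP => rho_lt.
  have : 2000%:R <= rho ^+ 2.
    apply: le_trans rho_sqr; rewrite ler_nat; apply: leq_trans size_ge _.
    by rewrite !card_sum !card_ord addnC.
  nra.
have t_gt1 : 1 < t by lra.
have path_n n : resolvent_total rho (path_graph n) (path_total t n).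
  by rewrite rhoE; exact: path_resolvent_total.
have [W4 [WT [F_W4 T_WT WE]]] := (resolvent_total_unionP _ _ _ _).1 F1W.
have F2W := resolvent_total_union (resolvent_total_union (resolvent_total_union
  (resolvent_total_union (path_n (n1 - 1)%N) (path_n (n2 + 1)%N))
  (path_n (n3 + 1)%N)) (path_n (n4 - 1)%N)) T_WT.
apply: rho_max F2W _; rewrite WE ltrD2r !addn1 !subn1.
have -> : W4 = path_total t n1 + path_total t n2 + path_total t n3
    + path_total t n4.
  by apply: resolvent_total_unique F_W4 _; do 3?apply: resolvent_total_union.
have n1_gt0 : (0 < n1)%N by lia.
rewrite -{1}(prednK n1_gt0) -{1}(prednK n4_ge1).
by apply: path_totals_lt => //; rewrite prednK.
Qed.
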